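(* Let $\mathcal{A}=\{A_1,\dots,A_m\}$ with $A_i\in\mathbb{R}^{n\times n}$ for $i\in[m]$, and let $\mathcal{M}=(Q,U,f)$ be a deterministic finite automaton with $Q=\{q_1,\dots,q_\ell\}$ and $U=\{1,\dots,m\}$. Let $\sigma(k)\in\Delta_m$ be the vector form of the input at time step $k$, let $x(k)\in\mathbb{R}^n$ be the state of the switched system $S(\mathcal{A})$ at time $k$ and let $q(k)\in\Delta_\ell^e$ be the vector form of the state of $\mathcal{M}$ at time $k$, both driven by the same input, and let $\xi(k)=q(k)\ltimes x(k)\in\mathbb{R}^{n\ell}$ be the state of the constrained switching system $S(\mathcal{A},\mathcal{M})$. Then the matrix expression of the dynamics of $S(\mathcal{A},\mathcal{M})$ is $$\xi(k+1)=\Phi\ltimes\sigma(k)\ltimes\xi(k),$$ where $$\Phi=[\Phi_1\ \cdots\ \Phi_m]\in\mathbb{R}^{n\ell\times mn\ell},\qquad \Phi_i=F_i\otimes A_i\in\mathbb{R}^{n\ell\times n\ell}\ \text{ for all } i\in[m],$$ and $F_i\in\mathbb{R}^{\ell\times\ell}$ is the matrix whose $(s,t)$ entry is $1$ if $f(q_t,i)$ is defined and $q_s=f(q_t,i)$, and $0$ otherwise.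
   Context: Notation: $[m]=\{1,\dots,m\}$. $\delta_n^k$ is the $k$-th column of the identity matrix $I_n$ for $k\in[n]$, $\delta_n^0$ is the zero vector of $\mathbb{R}^n$, $\Delta_n=\{\delta_n^1,\dots,\delta_n^n\}$, and $\Delta_n^e=\Delta_n\cup\{\delta_n^0\}$. $\otimes$ is the Kronecker product. Semi-tensor product (STP): for $A\in\mathbb{R}^{a\times b}$ and $B\in\mathbb{R}^{c\times d}$, $A\ltimes B=(A\otimes I_{s/b})(B\otimes I_{s/c})$, where $s$ is the least common multiple of $b$ and $c$. It is associative and coincides with the ordinary matrix product when $b=c$; for column vectors $q,x$ one has $q\ltimes x=q\otimes x$. Deterministic finite automaton (DFA): a triple $\mathcal{M}=(Q,U,f)$ with finite state set $Q=\{q_1,\dots,q_\ell\}$, finite input set $U=\{1,\dots,m\}$, and a partial transition function $f:Q\times U\to Q$; it is assumed that for each $q\in Q$ there is at least one $u\in U$ such that $f(q,u)$ is defined. Switched system $S(\mathcal{A})$: $x(k+1)=A_{\sigma_k}x(k)$, $x(k)\in\mathbb{R}^n$, $\sigma_k\in[m]$, $k\in\mathbb{Z}_{\ge0}$. The vector form of the input $\sigma_k=i$ is $\sigma(k)=\delta_m^i$. Vector form of the automaton state: the state $q_s$ is identified with $\delta_\ell^s$, and $\delta_\ell^0$ represents an undefined state. With input $\sigma_k=i$: if $q(k)=\delta_\ell^t$ with $t\in[\ell]$ and $f(q_t,i)$ is defined and equals $q_s$, then $q(k+1)=\delta_\ell^s$; if $q(k)=\delta_\ell^t$ and $f(q_t,i)$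 is undefined, or if $q(k)=\delta_\ell^0$, then $q(k+1)=\delta_\ell^0$. The constrained switching system $S(\mathcal{A},\mathcal{M})$ is the switched system $S(\mathcal{A})$ whose switching sequences are constrained to be accepted by $\mathcal{M}$, i.e. such that some state sequence of $\mathcal{M}$ follows defined transitions along the switching sequence; its state at time $k$ in the lifted form is $\xi(k)=q(k)\ltimes x(k)$. *)

(* Defs.v *)
From HB Require Import structures.
From mathcomp Require Import all_boot all_order all_algebra.
From mathcomp Require Import reals.
From mathcomp Require Export mxtens.

Set Implicit Arguments.
Unset Strict Implicit.
Unset Printing Implicit Defensive.

Import Order.TTheory GRing.Theory Num.Theory.
Local Open Scope ring_scope.

(* The semi-tensor product.  Its dimensions only reduce to the expected ones up
   to arithmetic identities such as a * (lcmn b c %/ b) = a when b = c; matrices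
   with provably equal dimensions are compared with [mx_heq] below. *)

Lemma stp_dvdl (b c : nat) : (b * (lcmn b c %/ b))%N = lcmn b c.
Proof. by rewrite mulnC divnK // dvdn_lcml. Qed.

Lemma stp_dvdr (b c : nat) : (c * (lcmn b c %/ c))%N = lcmn b c.
Proof. by rewrite mulnC divnK // dvdn_lcmr. Qed.

Definition stp (R : realType) (a b c d : nat) (A : 'M[R]_(a, b))
    (B : 'M[R]_(c, d)) :
    'M[R]_((a * (lcmn b c %/ b))%N, (d * (lcmn b c %/ c))%N) :=
  castmx (erefl _, stp_dvdl b c) (A *t (1%:M : 'M[R]_(lcmn b c %/ b)))
  *m castmx (stp_dvdr b c, erefl _) (B *t (1%:M : 'M[R]_(lcmn b c %/ c))).

Notation "A |>< B" := (stp A B) (at level 40, left associativity) : ring_scope.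

(* Equality of matrices, including equality of their dimensions. *)
Definition mx_heq (R : realType) (m n m' n' : nat) (A : 'M[R]_(m, n))
    (B : 'M[R]_(m', n')) : Prop :=
  exists e : (m = m') * (n = n'), castmx e A = B.

Notation "A =mx B" := (mx_heq A B) (at level 70, no associativity) : ring_scope.

(* The states q_1, ..., q_l and the inputs 1, ..., m are represented by 'I_l and
   'I_m; [trans t i = None] means that f(q_t, i) is undefined. *)
Record dfa (l m : nat) := DFA {
  trans : 'I_l -> 'I_m -> option 'I_l;
  trans_live : forall t : 'I_l, exists i : 'I_m, trans t i <> None
}.

Definition delta (R : realType) (n : nat) (k : 'I_n) : 'cV[R]_n :=
  col k 1%:M.

Arguments delta R {n} k.

(* The set Delta_n^e; delta_n^0 is the zero vector. *)
Definition Delta_ext (R : realType) (n : nat) (v : 'cV[R]_n) : Prop :=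
  (exists k : 'I_n, v = delta R k) \/ v = 0.

(* [dfa_step M i v w]: under the input i, the automaton state with vector form
   v is followed by the one with vector form w. *)
Inductive dfa_step (R : realType) (l m : nat) (M : dfa l m) (i : 'I_m) :
    'cV[R]_l -> 'cV[R]_l -> Prop :=
| step_defined (t s : 'I_l) :
    trans M t i = Some s -> dfa_step M i (delta R t) (delta R s)
| step_undefined (t : 'I_l) :
    trans M t i = None -> dfa_step M i (delta R t) 0
| step_dead : dfa_step M i 0 0.

Definition dfa_mx (R : realType) (l m : nat) (M : dfa l m) (i : 'I_m) :
    'M[R]_l :=
  \matrix_(s, t) (if trans M t i == Some s then 1 else 0).

Arguments dfa_mx R {l m} M i.

(* The number of columns is m * (l * n), in the form of the constant sum
   produced by [\mxrow]. *)
Definition Phi (R : realType) (n l m : nat) (A : 'I_m -> 'M[R]_n)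
    (M : dfa l m) : 'M[R]_((l * n)%N, (\sum_(i < m) l * n)%N) :=
  \mxrow_(i < m) (dfa_mx R M i *t A i).

(* Main.v *)
Require Import Defs.
From HB Require Import structures.
From mathcomp Require Import all_boot all_order all_algebra.
From mathcomp Require Import reals.

Set Implicit Arguments.
Unset Strict Implicit.
Unset Printing Implicit Defensive.

Import Order.TTheory GRing.Theory Num.Theory.
Local Open Scope ring_scope.

(** Write [i] for the input at the current time.  In the product
    [Phi |>< delta i |>< xi], the vector [delta i] selects the block
    [Phi_i = F_i *t A_i] ([mxrow_stp_delta]): with [p = l * n], the product
    [Phi |>< delta i] is [Phi *m (delta i *t 1_p)], and the columns of
    [delta i *t 1_p] are the unit vectors at the positions [i * p + k], which
    are those of the [i]-th block.  Next, [xi] is the Kronecker product of [q]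
    and [x] ([stp_col]), so the mixed-product property of Kronecker products
    splits the dynamics:
    [(F_i *t A_i) *m (q *t x) = (F_i *m q) *t (A_i *m x)].
    The second factor is the next state of the switched system.  The first is
    the next state of the automaton ([dfa_stepE]), because the column [t] of
    [F_i] is the vector form of the successor of [q_t] under [i], and is zero
    when there is none.

    The dimensions agree only up to arithmetic identities, so the argument is
    a chain of [=mx] steps.  This relation is an equivalence and a congruence
    for both products, and it absorbs casts. *)

(** * Matrices equal up to their dimensions *)

Lemma mx_heq_refl (R : realType) a b (A : 'M[R]_(a, b)) : A =mx A.
Proof. by exists (erefl, erefl); rewrite castmx_id. Qed.

Lemma mx_heq_sym (R : realType) a b a' b' (A : 'M[R]_(a, b))
  (B : 'M[R]_(a', b')) : A =mx B -> B =mx A.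
Proof.
by case=> [[ea eb]] <-; case: a' / ea B; case: b' / eb => _; exact: mx_heq_refl.
Qed.

Lemma mx_heq_trans (R : realType) a b a' b' a'' b'' (A : 'M[R]_(a, b))
  (B : 'M[R]_(a', b')) (C : 'M[R]_(a'', b'')) :
  A =mx B -> B =mx C -> A =mx C.
Proof.
case=> [[ea eb]] <-; case=> [[ea' eb']] <-.
by exists (etrans ea ea', etrans eb eb'); rewrite castmx_comp.
Qed.

Lemma castmx_heq (R : realType) a b a' b' (e : (a = a') * (b = b'))
  (A : 'M[R]_(a, b)) : castmx e A =mx A.
Proof. by apply: mx_heq_sym; exists e. Qed.

Lemma mx_heq_mul (R : realType) a b c a' b' c' (A : 'M[R]_(a, b))
  (B : 'M[R]_(b, c)) (A' : 'M[R]_(a', b')) (B' : 'M[R]_(b', c')) :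
  A =mx A' -> B =mx B' -> A *m B =mx A' *m B'.
Proof.
case=> [[ea eb]] <- {A'}; case=> [[eb' ec]] <- {B'}; exists (ea, ec).
case: a' / ea; case: c' / ec; case: b' / eb eb' => eb'.
by rewrite (eq_irrelevance eb' erefl) !castmx_id.
Qed.

Lemma mx_heq_stp (R : realType) a b c d a' b' c' d' (A : 'M[R]_(a, b))
  (B : 'M[R]_(c, d)) (A' : 'M[R]_(a', b')) (B' : 'M[R]_(c', d')) :
  A =mx A' -> B =mx B' -> A |>< B =mx A' |>< B'.
Proof.
case=> [[ea eb]] <- {A'}; case=> [[ec ed]] <- {B'}.
by case: a' / ea; case: b' / eb; case: c' / ec; case: d' / ed;
   rewrite !castmx_id; exact: mx_heq_refl.
Qed.

Lemma tensmx1_heq (R : realType) a b (A : 'M[R]_(a, b)) :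
  A *t (1%:M : 'M[R]_1) =mx A.
Proof. by rewrite tens_mx_scalar scale1r; exact: castmx_heq. Qed.

Lemma tens1mx_heq (R : realType) a b (A : 'M[R]_(a, b)) :
  (1%:M : 'M[R]_1) *t A =mx A.
Proof. by rewrite tens_scalar_mx scale1r; exact: castmx_heq. Qed.

(** * Special cases of the semi-tensor product *)

(** Replaces the quotients by the least common multiple in the definition of
    the product with any explicit cofactors [u] and [v], which lets the
    dimensions compute. *)
Lemma stp_heq (R : realType) a b c d u v w (A : 'M[R]_(a, b))
  (B : 'M[R]_(c, d)) (hu : (b * u)%N = w) (hv : (c * v)%N = w) :
  (0 < w)%N -> lcmn b c = w ->
  A |>< B =mx castmx (erefl, hu) (A *t (1%:M : 'M[R]_u))
              *m castmx (hv, erefl) (B *t (1%:M : 'M[R]_v)).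
Proof.
move=> w_gt0 lcm_w; case: w / lcm_w hu hv w_gt0 => hu hv w_gt0.
have [b_gt0 c_gt0] : (0 < b)%N /\ (0 < c)%N.
  by move: w_gt0; rewrite lcmn_gt0 => /andP.
have eu : (lcmn b c %/ b = u)%N by rewrite -hu mulKn.
have ev : (lcmn b c %/ c = v)%N by rewrite -hv mulKn.
case: u / eu hu => hu; case: v / ev hv => hv.
rewrite (eq_irrelevance hu (stp_dvdl b c)) (eq_irrelevance hv (stp_dvdr b c)).
exact: mx_heq_refl.
Qed.

Lemma stp_dvd (R : realType) a c p d (A : 'M[R]_(a, (c * p)%N))
  (B : 'M[R]_(c, d)) : (0 < c * p)%N ->
  A |>< B =mx A *m (B *t (1%:M : 'M[R]_p)).
Proof.
move=> cp_gt0.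
have lcm_cp : lcmn (c * p) c = (c * p)%N.
  by apply/eqP; rewrite eqn_dvd dvdn_lcml dvdn_lcm dvdnn dvdn_mulr.
apply: mx_heq_trans (stp_heq A B (muln1 _) erefl cp_gt0 lcm_cp) _.
apply: mx_heq_mul; last exact: castmx_heq.
exact: mx_heq_trans (castmx_heq _ _) (tensmx1_heq _).
Qed.

Lemma stp_mul (R : realType) a b d (A : 'M[R]_(a, b)) (B : 'M[R]_(b, d)) :
  (0 < b)%N -> A |>< B =mx A *m B.
Proof.
move=> b_gt0; apply: mx_heq_trans (stp_heq A B (muln1 b) (muln1 b) b_gt0 _) _.
  by apply/eqP; rewrite eqn_dvd dvdn_lcml dvdn_lcm dvdnn.
by apply: mx_heq_mul; exact: mx_heq_trans (castmx_heq _ _) (tensmx1_heq _).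
Qed.

(** A column [B] can be read both as [B *t 1_1] and as [1_1 *t B]; the latter
    turns [(A *t 1_c) *m B] into a Kronecker product. *)
Lemma stp_col (R : realType) a c (A : 'cV[R]_a) (B : 'cV[R]_c) :
  (0 < c)%N -> A |>< B =mx A *t B.
Proof.
move=> c_gt0.
apply: mx_heq_trans (stp_heq A B (mul1n c) (muln1 c) c_gt0 (lcm1n c)) _.
have -> : A *t B = (A *t 1%:M) *m (1%:M *t B).
  by rewrite tensmx_mul mulmx1 mul1mx.
apply: mx_heq_mul; first exact: castmx_heq.
apply: mx_heq_trans (castmx_heq _ _) _.
exact: mx_heq_trans (tensmx1_heq _) (mx_heq_sym (tens1mx_heq _)).
Qed.

(** * Selecting a block of a row of matrices *)

(** With blocks of equal width [p], the [k]-th column of the [i]-th block sits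
    at position [i * p + k], which is also how Kronecker products number the
    pair [(i, k)]. *)
Lemma mxrow_tensE (R : realType) m a p (B : 'I_m -> 'M[R]_(a, p))
  (e : (\sum_(i < m) p = m * p)%N) r i k :
  castmx (erefl, e) (\mxrow_(j < m) B j) r (mxtens_index (i, k)) = B i r k.
Proof.
rewrite castmxE /= cast_ord_id.
have -> : cast_ord (esym e) (mxtens_index (i, k))
          = tagnat.Rank (p_ := fun=> p) i k.
  apply: val_inj; symmetry; rewrite [LHS]tagnat.RankEsum sum_nat_const; congr (_ * _ + _)%N.
  rewrite -sum1_card (eq_bigl (fun j : 'I_m => (j < i)%N)) //.
  by rewrite -(big_ord_widen _ (fun=> 1%N) (ltnW (ltn_ord i))) sum1_card card_ord.
by rewrite -[in RHS](mxrowK B i) [RHS]mxE.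
Qed.

Lemma mulmx_delta_tensE (R : realType) m a p (X : 'M[R]_(a, (m * p)%N))
  (i : 'I_m) r z k :
  (X *m (delta R i *t (1%:M : 'M[R]_p))) r (mxtens_index (z, k))
  = X r (mxtens_index (i, k)).
Proof.
rewrite mxE (bigD1 (mxtens_index (i, k))) //= tensmxE !mxE !eqxx !mulr1.
rewrite big1 ?addr0 // => s; case: (mxtens_indexP s) => i' k' neq_s.
rewrite tensmxE !mxE; case: eqP => [ei|_]; last by rewrite mul0r mulr0.
case: eqP => [ek|_]; last by rewrite !mulr0.
by rewrite ei ek eqxx in neq_s.
Qed.

Lemma mxrow_stp_delta (R : realType) m a p (B : 'I_m -> 'M[R]_(a, p))
  (i : 'I_m) : (0 < p)%N ->
  (\mxrow_(j < m) B j) |>< delta R i =mx B i.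
Proof.
move=> p_gt0.
have e : (\sum_(i < m) p = m * p)%N by rewrite sum_nat_const card_ord.
have mp_gt0 : (0 < m * p)%N by rewrite muln_gt0 p_gt0 (leq_trans _ (ltn_ord i)).
apply: (@mx_heq_trans _ _ _ _ _ _ _ _
  (castmx (erefl, e) (\mxrow_(j < m) B j) |>< delta R i)).
  by apply: mx_heq_stp; [apply: mx_heq_sym; exact: castmx_heq|exact: mx_heq_refl].
apply: mx_heq_trans (stp_dvd _ _ mp_gt0) _.
apply: mx_heq_sym; exists (erefl, esym (mul1n p)).
apply/matrixP => r s; case: (mxtens_indexP s) => z k.
rewrite mulmx_delta_tensE mxrow_tensE castmxE cast_ord_id /=.
by congr (B i r _); apply: val_inj; rewrite /= ord1.
Qed.

(** * The automaton in matrix form *)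

Lemma dfa_mx_delta (R : realType) l m (M : dfa l m) (i : 'I_m) (t : 'I_l) :
  dfa_mx R M i *m delta R t
  = if trans M t i is Some s then delta R s else 0.
Proof.
rewrite /delta colEsub mulmx_colsub mulmx1; apply/colP => s; rewrite !mxE.
case: (trans M t i) => [s'|]; last by rewrite !mxE.
by rewrite !mxE (inj_eq Some_inj) eq_sym; case: eqP.
Qed.

Lemma dfa_stepE (R : realType) l m (M : dfa l m) (i : 'I_m) (v w : 'cV[R]_l) :
  dfa_step M i v w -> dfa_mx R M i *m v = w.
Proof.
by case=> [t s ts|t tN|]; rewrite ?mulmx0 // dfa_mx_delta ?ts ?tN.
Qed.

Theorem theorem1 (R : realType) (n l m : nat) (hn : (0 < n)%N) (hl : (0 < l)%N)
    (A : 'I_m -> 'M[R]_n) (M : dfa l m)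
    (sigma : nat -> 'I_m)
    (x : nat -> 'cV[R]_n) (hx : forall k, x k.+1 = A (sigma k) *m x k)
    (q : nat -> 'cV[R]_l) (hqD : forall k, Delta_ext (q k))
    (hq : forall k, dfa_step M (sigma k) (q k) (q k.+1))
    (xi : nat -> 'cV[R]_(n * l)) (hxi : forall k, q k |>< x k =mx xi k) :
  forall k : nat,
    Phi A M |>< delta R (sigma k) |>< xi k =mx xi k.+1.
Proof.
move=> k; have ln_gt0 : (0 < l * n)%N by rewrite muln_gt0 hl hn.
have xiE j : xi j =mx q j *t x j.
  exact: mx_heq_trans (mx_heq_sym (hxi j)) (stp_col _ _ hn).
apply: mx_heq_trans (mx_heq_sym (xiE k.+1)).
rewrite hx -(dfa_stepE (hq k)) -tensmx_mul.
apply: mx_heq_trans (stp_mul _ _ ln_gt0).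
by apply: mx_heq_stp (xiE k); exact: mxrow_stp_delta.
Qed.
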